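(* Let $G$ be a fine graph and $T$ a graph without isolated vertices, and let $\mathring T$ denote the reflexive graph obtained from $T$ by adding loops at all vertices. Then the inclusion map $i\colon\mathrm{Hom}(\mathring T,G)\to\mathrm{Hom}(T,G)$ (induced by the graph homomorphism $T\to\mathring T$ which is the identity on vertices) induces a homotopy equivalence of geometric realizations, with the homotopy inverse and the homotopies natural in $T$ and with respect to automorphisms of $G$.
   Context: Graphs are finite, undirected, loops allowed. $\mathrm{Hom}(A,B)$ is the poset of maps $\alpha\colon V(A)\to2^{V(B)}\setminus\{\emptyset\}$ such that whenever $a\sim a'$ in $A$ every element of $\alpha(a)$ is adjacent to every element of $\alpha(a')$, ordered by pointwise inclusion; $\mathrm{Hom}(\mathring T,G)$ is a subposet of $\mathrm{Hom}(T,G)$. For $M\subseteq V(G)$ let $\nu(M)=\{v\in V(G): (u,v)\in E(G)\text{ for all }u\in M\}$. A graph $G$ is fine if for every $M\subseteq V(G)$ with $M\neq\emptyset$ and $\nu(M)\neq\emptyset$ we have $\nu(M)\cap\nu(\nu(M))\neq\emptyset$. A vertex is isolated if it has no neighbor. *)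

(* Defs.v *)
From HB Require Import structures.
From mathcomp Require Import all_boot all_order all_algebra.
From mathcomp Require Import all_classical all_reals topology normedtype.

Set Implicit Arguments.
Unset Strict Implicit.
Unset Printing Implicit Defensive.

Import Order.TTheory GRing.Theory Num.Theory.
Import numFieldNormedType.Exports.

Local Open Scope classical_set_scope.
Local Open Scope ring_scope.

Record graph := Graph {
  vertex :> finType;
  edge : rel vertex;
  edge_sym : symmetric edge }.

(* Common neighbors of M. *)
Definition nu (G : graph) (M : {set G}) : {set G} :=
  [set v | [forall u in M, edge u v]].

Definition fine_graph (G : graph) : Prop :=
  forall M : {set G},
    M != finset.set0 -> nu M != finset.set0 -> nu M :&: nu (nu M) != finset.set0.

Definition no_isolated (T : graph) : Prop := forall v : T, exists w, edge v w.

Record graph_hom (A B : graph) := GraphHom {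
  hom_fun :> A -> B;
  hom_edge : forall a a', edge a a' -> edge (hom_fun a) (hom_fun a') }.

Definition is_automorphism (G : graph) (s : graph_hom G G) : Prop :=
  exists s' : graph_hom G G, cancel s s' /\ cancel s' s.

Section Looped.
Variable T : graph.

Definition looped_edge : rel T := [rel a b | (a == b) || edge a b].

Lemma looped_edge_sym : symmetric looped_edge.
Proof. by move=> a b; rewrite /looped_edge /= eq_sym edge_sym. Qed.

Definition looped : graph := Graph looped_edge_sym.

Lemma looped_inc_subproof (a b : T) : edge a b -> @edge looped a b.
Proof. by move=> ab; apply/orP; right. Qed.

Definition looped_inc : graph_hom T looped :=
  @GraphHom T looped id looped_inc_subproof.
End Looped.

Lemma looped_hom_subproof (A B : graph) (f : graph_hom A B) (a b : looped A) :
  edge a b -> @edge (looped B) (f a) (f b).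
Proof.
by case/orP=> [/eqP-> | ab]; apply/orP; [left | right; apply: hom_edge].
Qed.

Definition looped_hom (A B : graph) (f : graph_hom A B) :
    graph_hom (looped A) (looped B) :=
  @GraphHom (looped A) (looped B) f (@looped_hom_subproof A B f).

Section HomPoset.
Variables A B : graph.

Definition is_multihom (alpha : {ffun A -> {set B}}) : bool :=
  [forall a, alpha a != finset.set0] &&
  [forall a, forall a', edge a a' ==>
    [forall b in alpha a, forall b' in alpha a', edge b b']].

Record Hom := MkHom {
  hom_val :> {ffun A -> {set B}};
  hom_valP : is_multihom hom_val }.

HB.instance Definition _ := [isSub for hom_val].
HB.instance Definition _ := [Finite of Hom by <:].

Definition Hom_le : rel Hom :=
  fun alpha beta => [forall a, alpha a \subset beta a].

Lemma Hom_le_refl : reflexive Hom_le.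
Proof. by move=> alpha; apply/forallP. Qed.

Lemma Hom_le_anti : antisymmetric Hom_le.
Proof.
move=> alpha beta /andP[/forallP le_ab /forallP le_ba].
by apply/val_inj/ffunP=> a; apply/eqP; rewrite finset.eqEsubset le_ab le_ba.
Qed.

Lemma Hom_le_trans : transitive Hom_le.
Proof.
move=> beta alpha gamma /forallP le_ab /forallP le_bc.
by apply/forallP=> a; apply: fintype.subset_trans (le_ab a) (le_bc a).
Qed.

Fact Hom_display : Order.disp_t. Proof. exact: Order.Disp tt tt. Qed.

HB.instance Definition _ := Order.Le_isPOrder.Build Hom_display Hom
  Hom_le_refl Hom_le_anti Hom_le_trans.
End HomPoset.

Section Pullback.
Variables (A B G : graph) (f : graph_hom A B).

Lemma pullback_subproof (alpha : Hom B G) :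
  is_multihom [ffun a => alpha (f a)].
Proof.
have /andP[/forallP alpha_n0 /forallP alpha_e] := hom_valP alpha.
apply/andP; split; apply/forallP=> a; rewrite ?ffunE //.
apply/forallP=> a'; apply/implyP=> /(hom_edge f) faa'; rewrite !ffunE.
by have /forallP/(_ (f a'))/implyP/(_ faa') := alpha_e (f a).
Qed.

Definition pullback (alpha : Hom B G) : Hom A G :=
  MkHom (pullback_subproof alpha).

Lemma pullback_mono : {homo pullback : alpha beta / (alpha <= beta)%O}.
Proof.
by move=> alpha beta /forallP le_ab; apply/forallP=> a; rewrite !ffunE.
Qed.

HB.instance Definition _ :=
  Order.isOrderMorphism.Build _ _ _ _ pullback pullback_mono.
End Pullback.

Section Pushforward.
Variables (T G G' : graph) (s : graph_hom G G').

Lemma pushforward_subproof (alpha : Hom T G) :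
  is_multihom [ffun t => s @: alpha t].
Proof.
have /andP[/forallP alpha_n0 /forallP alpha_e] := hom_valP alpha.
apply/andP; split; apply/forallP=> t.
  by rewrite ffunE finset.imset_eq0.
apply/forallP=> t'; apply/implyP=> tt'; rewrite !ffunE.
have /forallP/(_ t')/implyP/(_ tt')/forall_inP edge_tt' := alpha_e t.
apply/forall_inP=> _ /imsetP[u ut ->]; apply/forall_inP=> _ /imsetP[v vt' ->].
by apply: hom_edge; have /forall_inP := edge_tt' u ut; apply.
Qed.

Definition pushforward (alpha : Hom T G) : Hom T G' :=
  MkHom (pushforward_subproof alpha).

Lemma pushforward_mono : {homo pushforward : alpha beta / (alpha <= beta)%O}.
Proof.
move=> alpha beta /forallP le_ab; apply/forallP=> t.
by rewrite !ffunE; apply: finset.imsetS.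
Qed.

HB.instance Definition _ :=
  Order.isOrderMorphism.Build _ _ _ _ pushforward pushforward_mono.
End Pushforward.

(* Points of the realization of the order complex of P are given by their
   barycentric coordinates: convex combinations supported on a chain. As P is
   finite, the weak topology is the one induced by R^P. *)
Definition realization_set (R : realType) d (P : finPOrderType d) :
    set {ptws P -> R} :=
  [set x | [/\ forall p, 0 <= x p, \sum_(p : P) x p = 1 &
              forall p q, x p != 0 -> x q != 0 -> (p >=< q)%O]].

Definition realization (R : realType) d (P : finPOrderType d) :
  topologicalType := set_type (@realization_set R d P).

Section RealizationMap.
Variables (R : realType) (d d' : Order.disp_t).
Variables (P : finPOrderType d) (Q : finPOrderType d') (f : {omorphism P -> Q}).

Lemma realization_map_subproof (x : realization R P) :
  (fun q => \sum_(p : P | f p == q) \val x p) \in @realization_set R d' Q.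
Proof.
have [x_ge0 x_sum1 x_chain] := set_valP x.
rewrite inE; split=> [q||q q'].
- exact: sumr_ge0.
- by rewrite -x_sum1 [RHS](partition_big f xpredT).
have nz r : \sum_(p : P | f p == r) \val x p != 0 ->
    exists2 p, f p = r & \val x p != 0.
  move=> sum_n0; have [/existsP[p /andP[/eqP fp xp]] | /existsPn xf0] :=
    boolP [exists p, (f p == r) && (\val x p != 0)]; first by exists p.
  case/eqP: sum_n0; apply: big1 => p fp.
  by have := xf0 p; rewrite fp /= negbK => /eqP.
move=> /nz[p <- xp] /nz[p' <- xp'].
by have /orP[] := x_chain p p' xp xp' => le; rewrite /Order.comparable
  (omorph_le f le) ?orbT.
Qed.

Definition realization_map (x : realization R P) : realization R Q :=
  SigSub (realization_map_subproof x).
End RealizationMap.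

Section Homotopy.
Variable R : realType.

Definition unit_interval : topologicalType := set_type `[(0 : R), 1].

Lemma unit_interval0_subproof : (0 : R) \in `[(0 : R), 1]%classic.
Proof. by rewrite inE /= in_itv /= lexx ler01. Qed.

Lemma unit_interval1_subproof : (1 : R) \in `[(0 : R), 1]%classic.
Proof. by rewrite inE /= in_itv /= lexx ler01. Qed.

Definition unit_interval0 : unit_interval := SigSub unit_interval0_subproof.
Definition unit_interval1 : unit_interval := SigSub unit_interval1_subproof.

Definition is_homotopy (X Y : topologicalType) (f g : X -> Y)
    (H : X * unit_interval -> Y) : Prop :=
  [/\ continuous H, forall x, H (x, unit_interval0) = f x &
      forall x, H (x, unit_interval1) = g x].

(* g is a homotopy inverse of f, witnessed by the homotopies H and K. *)
Definition homotopy_equivalence_data (X Y : topologicalType)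
    (f : X -> Y) (g : Y -> X)
    (H : Y * unit_interval -> Y) (K : X * unit_interval -> X) : Prop :=
  [/\ continuous f, continuous g, is_homotopy (f \o g) idfun H &
      is_homotopy (g \o f) idfun K].
End Homotopy.

Section RealizedHom.
Variable R : realType.

Definition rHom (A B : graph) : topologicalType := realization R (Hom A B).

Definition rpullback (A B G : graph) (f : graph_hom A B) :
  rHom B G -> rHom A G := realization_map (pullback f).

Definition rpushforward (T G G' : graph) (s : graph_hom G G') :
  rHom T G -> rHom T G' := realization_map (pushforward s).

Definition rinclusion (T G : graph) : rHom (looped T) G -> rHom T G :=
  rpullback (looped_inc T).
End RealizedHom.

(* Main.v *)
(* A point x of |Hom(A, G)| is determined by its membership function m(a, g) =
   sum of the x_p over the cells p with g in p(a). These functions are exactly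
   the maps m : A * G -> [0, 1] with maximum 1 over each vertex of A and with
   edge-compatible supports, and the correspondence is a homeomorphism onto
   its image since |Hom(A, G)| is compact.
   Put core(x)(a, g) = max_M x_a(M) / max_M x_a(M), where x_a(M) is the total
   weight of the cells p with p(a) = M and the numerator is restricted to the
   sets M with g in nu(M) :&: nu(nu(M)). As M runs through a chain these
   intersections are pairwise adjacent, so core(x) is the membership function
   of a point j(x) of |Hom(looped A, G)|; fineness gives maximum 1. All
   supports lie in nu(nu(p(a))) for the top cell p, so any maximum of core(x)
   and m(x) with coefficients in [0, 1], one of them equal to 1, is again a
   membership function; this yields both homotopies. The value at (a, g)
   involves only the a-component of x, whence the naturality. *)
Require Import Defs.
From HB Require Import structures.
From mathcomp Require Import all_boot all_order all_algebra.
From mathcomp Require Import all_classical all_reals topology normedtype.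
From mathcomp Require Import lra.

Set Implicit Arguments.
Unset Strict Implicit.
Unset Printing Implicit Defensive.

Import Order.TTheory GRing.Theory Num.Theory.
Import numFieldNormedType.Exports.

Local Open Scope classical_set_scope.
Local Open Scope ring_scope.

(* The [Hom] of mathcomp.algebra.vector shadows the poset. *)
Local Notation Hom := Defs.Hom.

(** * Continuity into compact and product spaces *)

(** On the compact set [K] the map [phi] into a Hausdorff space is closed; by injectivity, the
    preimage of a closed set under [f] is then the preimage of a closed set under [phi \o f]. *)
Lemma continuous_through_compact (Z X Y : topologicalType) (K : set X)
    (phi : X -> Y) (f : Z -> X) :
  hausdorff_space Y -> compact K -> continuous phi -> {in K &, injective phi} ->
  (forall z, K (f z)) -> continuous (phi \o f) -> continuous f.
Proof.
move=> hY cK cphi injphi Kf cphif; apply/continuous_closedP => C clC.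
have -> : f @^-1` C = (phi \o f) @^-1` (phi @` (K `&` C)).
  apply/seteqP; split=> [z Cfz|z /= [x [Kx Cx] /injphi xfz]] /=.
    by exists (f z).
  by rewrite /preimage /= -xfz ?inE.
move/continuous_closedP: cphif; apply; apply: compact_closed => //.
apply: continuous_compact; first exact: continuous_subspaceT.
exact: compact_closedI.
Qed.

Lemma continuous_ptws (Z : topologicalType) (I : Type) (Y : topologicalType)
    (f : Z -> {ptws I -> Y}) :
  (forall i, continuous (fun z => f z i)) -> continuous f.
Proof.
move=> cf z; apply/cvg_sup => i U [? /= [[W oW <-]] /= Wfz WU].
by apply: (filterS WU); apply: (cf i z); exact: open_nbhs_nbhs.
Qed.

Lemma continuous_eval (I : eqType) (Y : topologicalType) (i : I) :
  continuous (fun u : {ptws I -> Y} => u i).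
Proof. exact: (@proj_continuous I (fun=> Y) i). Qed.

(** * Compactness of the realization *)

Section Realization.
Variables (R : realType) (d : Order.disp_t) (P : finPOrderType d).

Lemma continuous_sum (Z : topologicalType) (I : Type) (r : seq I) (Q : pred I)
    (f : I -> Z -> R) :
  (forall i, continuous (f i)) -> continuous (fun z => \sum_(i <- r | Q i) f i z).
Proof. by move=> cf; apply: continuous_big => // -[a b]; exact: add_continuous. Qed.

Lemma realization_le1 (u : {ptws P -> R}) (Q : pred P) :
  realization_set u -> \sum_(p | Q p) u p <= 1.
Proof.
by case=> u0 <- _; rewrite [leRHS](bigID Q) /= lerDl sumr_ge0.
Qed.

(** A closed subset of a cube: the chain condition becomes the closed condition that [u p * u q]
    vanishes for incomparable [p] and [q]. *)
Lemma realization_compact : compact (@realization_set R d P).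
Proof.
pose cube := [set u : {ptws P -> R} | forall p, `[(0 : R), 1]%classic (u p)].
apply: (@subclosed_compact _ _ cube).
- have -> : @realization_set R d P =
      (\bigcap_p ((fun u : {ptws P -> R} => u p) @^-1` [set x | 0 <= x]))
      `&` ((fun u : {ptws P -> R} => \sum_p u p) @^-1` [set x | x = 1])
      `&` \bigcap_(pq in [set pq : P * P | ~~ (pq.1 >=< pq.2)%O])
        ((fun u : {ptws P -> R} => u pq.1 * u pq.2) @^-1` [set x | x = 0]).
    apply/seteqP; split=> u /=.
      case=> u0 u1 uc; split; [split=> // p _; exact: u0|].
      case=> p q /= npq; apply/eqP; rewrite mulf_eq0.
      by apply: contraNT npq; rewrite negb_or => /andP[]; exact: uc.
    case=> -[u0 u1 uc]; split=> // [p|p q up uq]; first exact: u0.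
    apply: contraTT isT => /(uc (p, q)) /= /eqP.
    by rewrite mulf_eq0 (negPf up) (negPf uq).
  apply: closedI; first apply: closedI.
  + apply: closed_bigI => p _; apply: closed_comp => [u _|]; last exact: closed_ge.
    exact: continuous_eval.
  + apply: closed_comp => [u _|]; last exact: closed_eq.
    by apply: continuous_sum => p; exact: continuous_eval.
  + apply: closed_bigI => pq _; apply: closed_comp => [u _|]; last exact: closed_eq.
    exact: (cvgM (@continuous_eval P R pq.1 u) (@continuous_eval P R pq.2 u)).
- apply: (@tychonoff P (fun=> R) (fun=> `[(0 : R), 1]%classic)) => p.
  exact: segment_compact.
- move=> u Ku p; rewrite /= in_itv /=; have [-> _ _] /= := Ku.
  by apply: le_trans (realization_le1 (pred1 p) Ku); rewrite big_pred1_eq.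
Qed.
End Realization.

(** * Membership functions and their characterization *)

Section Membership.
Variables (R : realType) (A G : graph).
Implicit Types (u v : {ptws Hom A G -> R}) (p q r : Hom A G) (i j : (A * G)%type).

Lemma HomP p q : reflect (forall i, i.2 \in p i.1 -> i.2 \in q i.1) (p <= q)%O.
Proof.
apply: (iffP forallP) => [le_pq [a g] /=|le_pq a]; first exact/fintype.subsetP/le_pq.
by apply/fintype.subsetP => g; exact: (le_pq (a, g)).
Qed.

Definition memb u : {ptws (A * G)%type -> R} :=
  fun i => \sum_(p : Hom A G | i.2 \in p i.1) u p.

(* By the chain condition the vertex i of p with the least membership lies in
   no cell of the support of u but those above p. *)
Lemma memb_upper u p : realization_set u ->
  let B := \sum_(q | (p <= q)%O) u q in
  [/\ B <= 1, forall i, i.2 \in p i.1 -> B <= memb u i &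
      B = 1 \/ exists2 i, i.2 \in p i.1 & B = memb u i].
Proof.
move=> Ku B; have [u0 u1 uc] := Ku.
have Bm i : i.2 \in p i.1 -> B <= memb u i.
  move=> ip; rewrite /B /memb [leRHS](bigID (>= p)%O) /=.
  rewrite [X in _ <= X + _](eq_bigl (fun q => (p <= q)%O)).
    by rewrite lerDl sumr_ge0.
  by move=> q; case: HomP => [/(_ i ip) ->|]; rewrite ?andbF.
split=> //; first exact: realization_le1.
have [/existsP[i0 i0p]|/existsPn p0] := boolP [exists i, i.2 \in p i.1]; last first.
  (* Cells are nonempty at each vertex, so here [A] has no vertex and every cell lies above [p]. *)
  left; rewrite -u1; apply: eq_bigl => q.
  by apply/HomP => i ip; have := p0 i; rewrite ip.
right; have [i ip imin] :=
  @arg_minP _ _ _ i0 (fun i : (A * G)%type => i.2 \in p i.1) (memb u) i0p.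
exists i => //; apply/le_anti; rewrite Bm //=.
rewrite {1}/memb big_mkcond [leRHS]big_mkcond /=; apply: ler_sum => r _.
have [ir|] := boolP (i.2 \in r i.1); last by case: ifP.
case: ifP => // /HomP npr; have [->//|ur] := eqVneq (u r) 0.
have [j jp jr] : exists2 j, j.2 \in p j.1 & j.2 \notin r j.1.
  apply: contrapT => nj; apply: npr => j jp.
  by apply: contrapT => /negP jr; apply: nj; exists j.
(* A support cell containing [j] cannot lie below [r], so it lies above [r] and contains [i]; [r]
   itself contains [i] but not [j]. Hence [j] would have smaller membership than [i]. *)
have := imin j jp; rewrite leNgt /memb => /negP[].
rewrite [ltRHS](bigD1 r) //= big_mkcond [X in _ < _ + X]big_mkcond /=.
rewrite ltr_pwDl ?lt_neqAle ?u0 1?eq_sym ?ur //; apply: ler_sum => q _.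
have [jq|_] := ifP; last by case: ifP.
have [->|uq] := eqVneq (u q) 0; first by case: ifP.
have /orP[/HomP le_rq|/HomP/(_ j jq)] := uc _ _ ur uq; last by rewrite (negPf jr).
by rewrite le_rq //=; case: eqP jr => // <-; rewrite jq.
Qed.

(** By [memb_upper] the total weight above a cell is the least of 1 and the memberships of its
    elements, so it depends on [memb u] alone. The single weights follow by induction from the top
    of the poset downwards. *)
Lemma memb_inj : {in @realization_set R _ (Hom A G) &, injective memb}.
Proof.
move=> u v /set_mem Ku /set_mem Kv uv; apply/funext => p.
have leB s t q : realization_set s -> realization_set t -> memb s = memb t ->
    \sum_(r | (q <= r)%O) s r <= \sum_(r | (q <= r)%O) t r.
  move=> Ks Kt st; have [_ _ [->|[i iq ->]]] := memb_upper q Kt.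
    by have [] := memb_upper q Ks.
  by rewrite -st; have [_ + _] := memb_upper q Ks; apply.
have eqB q : \sum_(r | (q <= r)%O) u r = \sum_(r | (q <= r)%O) v r.
  by apply/le_anti; rewrite !leB.
have [n] := ubnP #|[pred q | (p < q)%O]|; elim: n p => // n IH p pn.
have eqI w : \sum_(r | (p <= r)%O) w r = w p + \sum_(r | (p < r)%O) w r :> R.
  rewrite (bigD1 p) //=; congr (_ + _); apply: eq_bigl => r.
  by rewrite lt_neqAle eq_sym andbC.
have := eqB p; rewrite !eqI [in X in X = _](eq_bigr v) => [/addIr//|q pq].
apply: IH; apply: leq_trans (pn : (_ <= n)%N); apply: proper_card.
apply/properP; split; last by exists q; rewrite !inE ?ltxx.
by apply/fintype.subsetP => r; rewrite !inE; exact: lt_trans.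
Qed.

(* The membership functions of the points at height [c] of the cone over the
   realization; heights below 1 occur in the induction of [memb_surj]. *)
Definition fuzzy_hom (c : R) (m : (A * G)%type -> R) : Prop :=
  [/\ forall i, 0 <= m i <= c, forall a, exists g, m (a, g) = c &
      forall i j, edge i.1 j.1 -> 0 < m i -> 0 < m j -> edge i.2 j.2].

Lemma fuzzy_supp_subproof c m : 0 < c -> fuzzy_hom c m ->
  is_multihom [ffun a : A => [set g : G | 0 < m (a, g)]]%SET.
Proof.
move=> c0 [_ mc me]; apply/andP; split; apply/forallP => a.
  have [g mg] := mc a; apply/finset.set0Pn; exists g.
  by rewrite ffunE inE mg.
apply/forallP => b; apply/implyP => ab; rewrite !ffunE.
apply/forall_inP => g; rewrite inE => mg; apply/forall_inP => h; rewrite inE => mh.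
exact: (me (a, g) (b, h)).
Qed.

(* Each step peels off the lowest positive level of [m] other than the top. *)
Lemma memb_surj c m : 0 < c -> fuzzy_hom c m ->
  exists u, [/\ forall p, 0 <= u p, \sum_p u p = c,
    forall p q, u p != 0 -> u q != 0 -> (p >=< q)%O,
    forall p, u p != 0 -> forall i, i.2 \in p i.1 -> 0 < m i &
    memb u = m].
Proof.
have [n] := ubnP #|[pred i | 0 < m i < c]|; elim: n c m => // n IH c m mn c0 mF.
have [m01 mc me] := mF; pose S := MkHom (fuzzy_supp_subproof c0 mF).
have inS i : (i.2 \in S i.1) = (0 < m i) by rewrite ffunE inE; case: i.
pose D x : {ptws Hom A G -> R} := fun p => if p == S then x else 0.
have sumD x (Q : pred (Hom A G)) :
    \sum_(p | Q p) D x p = if Q S then x else 0.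
  by rewrite -big_mkcondr /= big_mkcond (bigD1 S) //= eqxx andbT big1 ?addr0 //
     => p /negPf ->; rewrite andbF.
have DS x p : D x p != 0 -> p = S by rewrite /D; case: (eqVneq p S) => // _; rewrite eqxx.
have [/existsP[i1 i1P]|/existsPn nP] := boolP [exists i, 0 < m i < c]; last first.
  (* Without intermediate levels [m] takes only the values 0 and [c], so all the mass sits on
     [S]. *)
  exists (D c); split=> [p||p q|p|].
  - by rewrite /D; case: ifP => // _; exact: ltW.
  - exact: (sumD c xpredT).
  - by move=> /DS -> /DS ->; rewrite comparablexx.
  - by move=> /DS -> i; rewrite inS.
  - apply/funext => i; rewrite /memb sumD inS; have /andP[mi0 mic] := m01 i.
    have := nP i; case: ltP => /= [mi|mi _]; last by apply/le_anti/andP.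
    by rewrite -leNgt => cm; apply/le_anti/andP.
have [i iP imin] := @arg_minP _ _ _ i1 (fun i => 0 < m i < c) m i1P.
have /andP[i0 ic] := iP.
pose m' j := Num.max 0 (m j - m i).
have m'_gt0 j : (0 < m' j) = (m i < m j) by rewrite lt_max ltxx subr_gt0.
have c'0 : 0 < c - m i by rewrite subr_gt0.
have m'F : fuzzy_hom (c - m i) m'.
  split=> [j|a|j k jk].
  - have /andP[_ jc] := m01 j.
    by rewrite le_max lexx /= ge_max (ltW c'0) lerD2r jc.
  - by have [g mg] := mc a; exists g; rewrite /m' mg max_r // ltW.
  - by rewrite !m'_gt0 => ij ik; apply: me => //; exact: lt_trans i0 _.
(* An index intermediate for [m'] is intermediate for [m], while [i] no longer is. *)
have [|u [u0 u1 uc us um]] := IH _ _ _ c'0 m'F.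
  apply: leq_trans (mn : (_ <= n)%N); apply: proper_card; apply/properP; split.
    apply/fintype.subsetP => j; rewrite !inE m'_gt0 => /andP[ij]; rewrite (lt_trans i0) //=.
    by rewrite gt_max ltrD2r => /andP[].
  by exists i; rewrite !inE ?iP // m'_gt0 ltxx.
have uS p : u p != 0 -> (p <= S)%O.
  move=> up; apply/HomP => j /(us p up); rewrite inS m'_gt0; exact: lt_trans.
have DN0 p : u p + D (m i) p != 0 -> p = S \/ u p != 0.
  by have [/DS ->|/negPn/eqP ->] := boolP (D (m i) p != 0); [left|rewrite addr0; right].
exists (fun p => u p + D (m i) p); split=> [p||p q|p|].
- by rewrite addr_ge0 // /D; case: ifP => // _; exact: ltW.
- by rewrite big_split /= u1 (sumD _ xpredT) subrK.
- move=> /DN0[->|up] /DN0[->|uq]; rewrite ?comparablexx //.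
  + by rewrite /Order.comparable (uS q uq) orbT.
  + by rewrite /Order.comparable (uS p up).
  + exact: uc.
- move=> /DN0[->|up] j; first by rewrite inS.
  by move=> /(us p up); rewrite m'_gt0; exact: lt_trans.
- apply/funext => j; rewrite /memb big_split /= sumD inS.
  have -> : \sum_(p : Hom A G | j.2 \in p j.1) u p = m' j by rewrite -um.
  have /andP[j0 jc] := m01 j; rewrite /m'.
  (* A positive [m j] is at least [m i], by minimality or because it equals [c]; adding the mass
     [m i] at [S] undoes the truncation. *)
  have [mj|mj] := ltP 0 (m j); last first.
    have -> : m j = 0 by apply/le_anti/andP.
    by rewrite addr0 max_l // sub0r oppr_le0 ltW.
  rewrite max_r ?subrK // subr_ge0.
  by have [jc'|jc'] := ltP (m j) c; [rewrite imin ?mj|exact: le_trans (ltW ic) jc'].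
Qed.
End Membership.

(** * Memberships as coordinates on the realization *)

Section Points.
Variables (R : realType) (A G : graph).
Implicit Types (x y : rHom R A G) (i j : (A * G)%type).

Lemma memb_ge0 x i : 0 <= memb (\val x) i.
Proof. by have [x0 _ _] := set_valP x; exact: sumr_ge0. Qed.

Lemma memb_gt0 x i : 0 < memb (\val x) i ->
  exists2 p : Hom A G, \val x p != 0 & i.2 \in p i.1.
Proof.
move=> mi; apply: contrapT => nx; move: mi; rewrite /memb big1 ?ltxx // => p ip.
by apply/eqP/negPn/negP => xp; apply: nx; exists p.
Qed.

Lemma Hom_edge (p : Hom A G) (a b : A) (g h : G) :
  edge a b -> g \in p a -> h \in p b -> edge g h.
Proof.
move=> ab gp hp; have /andP[_ /forallP/(_ a)/forallP/(_ b)] := hom_valP p.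
by move=> /implyP/(_ ab)/forall_inP/(_ g gp)/forall_inP/(_ h hp).
Qed.

(* The vertex of highest membership lies in every cell of the support. *)
Lemma memb_fuzzy x : fuzzy_hom 1 (memb (\val x)).
Proof.
have [x0 x1 xc] := set_valP x; split=> [i|a|i j ij /memb_gt0[p xp ip] /memb_gt0[q xq jq]].
- by rewrite memb_ge0; apply: realization_le1; exact: set_valP.
- have [p xp] : exists p, \val x p != 0.
    apply: contrapT => nx; move: x1; rewrite big1 => [/esym/eqP|p _].
      by rewrite oner_eq0.
    by apply/eqP/negPn/negP => xp; apply: nx; exists p.
  have /andP[/forallP/(_ a)/finset.set0Pn[g0 _] _] := hom_valP p.
  have [g _ gmax] := @arg_maxP _ _ _ g0 xpredT (fun g : G => memb (\val x) (a, g)) isT.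
  exists g; rewrite -x1 /memb big_mkcond; apply: eq_bigr => q _ /=.
  case: ifPn => // gq; apply/esym/eqP/negPn/negP => xq.
  have /andP[/forallP/(_ a)/finset.set0Pn[h hq] _] := hom_valP q.
  (* Support cells containing [g] are not below [q], so they contain [h]; as [q] contains [h] only,
     [h] would beat the maximum. *)
  have /= := gmax h isT; rewrite leNgt /memb => /negP[].
  rewrite [ltRHS](bigD1 q) //= big_mkcond [X in _ < _ + X]big_mkcond /=.
  rewrite ltr_pwDl ?lt_neqAle ?x0 1?eq_sym ?xq //; apply: ler_sum => r _.
  have [gr|_] := ifP; last by case: ifP => // _; exact: x0.
  have [->|xr] := eqVneq (\val x r) 0; first by case: ifP.
  have /orP[/HomP/(_ (a, h))/(_ hq) /= ->|/HomP/(_ (a, g))/(_ gr)] := xc _ _ xq xr.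
    by case: eqP gq => // <-; rewrite gr.
  by rewrite (negPf gq).
- have /orP[/HomP/(_ i ip) iq|/HomP/(_ j jq) jp] := xc _ _ xp xq.
    exact: Hom_edge ij iq jq.
  exact: Hom_edge ij ip jp.
Qed.

Lemma point_inj x y : memb (\val x) =1 memb (\val y) -> x = y.
Proof.
move=> xy; apply/val_inj/memb_inj; [exact: valP|exact: valP|].
exact/funext.
Qed.

Lemma point_surj m : fuzzy_hom 1 m -> exists x, memb (\val x) = m.
Proof.
case/(memb_surj ltr01) => u [u0 u1 uc _ um].
have Ku : u \in @realization_set R _ (Hom A G) by rewrite inE.
by exists (SigSub Ku).
Qed.

Lemma continuous_coord (p : Hom A G) : continuous (fun x => \val x p).
Proof.
have cval : continuous (\val : rHom R A G -> {ptws Hom A G -> R}).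
  exact: initial_continuous.
move=> x; exact: (continuous_comp (cval x) (@continuous_eval _ R p (\val x))).
Qed.

Lemma continuous_memb i : continuous (fun x => memb (\val x) i).
Proof. by apply: continuous_sum => p; exact: continuous_coord. Qed.

(** Continuity may be tested after [memb], which is continuous and injective on the compact
    realization. *)
Lemma continuous_rHom (Z : topologicalType) (f : Z -> rHom R A G) :
  (forall i, continuous (fun z => memb (\val (f z)) i)) -> continuous f.
Proof.
move=> cf; apply: continuous_comp_initial.
apply: (@continuous_through_compact _ _ {ptws (A * G)%type -> R}
  (@realization_set R _ (Hom A G)) (@memb R A G)).
- by apply: hausdorff_product => _; exact: Rhausdorff.
- exact: realization_compact.
- apply: continuous_ptws => i; apply: continuous_sum => p; exact: continuous_eval.
- exact: memb_inj.
- by move=> z; exact: set_valP.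
- exact: continuous_ptws.
Qed.
End Points.

(** * Common neighbors and the closure [nu (nu M)] *)

Section Closure.
Variable G : graph.
Implicit Types (M N : {set G}) (g h : G).

Lemma in_nu M g : reflect (forall h, h \in M -> edge h g) (g \in nu M).
Proof. by rewrite inE; exact: forall_inP. Qed.

Lemma nu_anti M N : M \subset N -> nu N \subset nu M.
Proof.
move=> /fintype.subsetP MN; apply/fintype.subsetP => g /in_nu Ng.
by apply/in_nu => h /MN; exact: Ng.
Qed.

Lemma sub_nu_nu M : M \subset nu (nu M).
Proof.
apply/fintype.subsetP => g Mg; apply/in_nu => h /in_nu/(_ g Mg).
by rewrite edge_sym.
Qed.

Definition core_set M : {set G} := nu M :&: nu (nu M).

(** Monotonicity of the closure puts [g] in [nu (nu N)], whose elements are adjacent to all of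
    [nu N]. For [M = N] the core set is thus a clique with loops, as [looped A] demands. *)
Lemma core_set_edge M N g h :
  M \subset N -> g \in core_set M -> h \in core_set N -> edge g h.
Proof.
move=> MN /setIP[_ gM] /setIP[hN _]; move/in_nu: hN => /= hN.
have /fintype.subsetP/(_ g gM) := nu_anti (nu_anti MN).
by move=> /in_nu/(_ h); rewrite edge_sym; apply; apply/in_nu.
Qed.

(** With [r] the larger cell, [r b] lies in [nu (r a)], so [nu (nu (r a))] lies in [nu (r b)], which
    is completely adjacent to [nu (nu (r b))]. *)
Lemma nu_nu_edge (A : graph) (p q : Hom A G) (a b : A) g h : (p >=< q)%O ->
  edge a b -> g \in nu (nu (p a)) -> h \in nu (nu (q b)) -> edge g h.
Proof.
move=> pq ab gp hq; pose r := if (p <= q)%O then q else p.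
have sub (c : A) : (p c \subset r c) && (q c \subset r c).
  rewrite /r; case: ifPn => [/forallP ->|/negPf npq]; first by rewrite subxx.
  by move: pq; rewrite /Order.comparable npq subxx => /forallP/(_ c) /= ->.
have /andP[pr _] := sub a; have /andP[_ qr] := sub b.
have /fintype.subsetP/(_ g gp) gr := nu_anti (nu_anti pr).
have /fintype.subsetP/(_ h hq) hr := nu_anti (nu_anti qr).
have rba : r b \subset nu (r a).
  apply/fintype.subsetP => k kb; apply/in_nu => l la; exact: Hom_edge ab la kb.
have /fintype.subsetP/(_ g gr) gb := nu_anti rba.
by move/in_nu: hr; apply.
Qed.
End Closure.

(** * The core map and its interpolation with the identity *)

Section Core.
Variables (R : realType) (A G : graph).
Implicit Types (x : rHom R A G) (i : (A * G)%type) (M : {set G}).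

Definition weight x (a : A) M : R := \sum_(p : Hom A G | p a == M) \val x p.

Definition max_weight x (a : A) (Q : pred {set G}) : R :=
  \big[Num.max/0]_(M | Q M) weight x a M.

Definition core x i : R :=
  max_weight x i.1 (fun M => i.2 \in core_set M) / max_weight x i.1 xpredT.

Lemma weight_ge0 x a M : 0 <= weight x a M.
Proof. by have [x0 _ _] := set_valP x; exact: sumr_ge0. Qed.

Lemma weight_gt0 x a M : 0 < weight x a M ->
  exists2 p : Hom A G, \val x p != 0 & p a = M.
Proof.
move=> wM; apply: contrapT => nx; move: wM; rewrite /weight big1 ?ltxx // => p /eqP pM.
by apply/eqP/negPn/negP => xp; apply: nx; exists p.
Qed.

Lemma max_weight_ge0 x a Q : 0 <= max_weight x a Q.
Proof. exact: bigmax_ge_id. Qed.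

Lemma max_weight_gt0 x a : 0 < max_weight x a xpredT.
Proof.
have [_ x1 _] := set_valP x; apply/bigmax_gtP; right; apply: contrapT => nx.
move: x1; rewrite (partition_big (fun p : Hom A G => p a) xpredT) //=.
rewrite big1 => [/esym/eqP|M _]; first by rewrite oner_eq0.
apply/le_anti; rewrite weight_ge0 andbT leNgt; apply/negP => wM.
by apply: nx; exists M.
Qed.

Lemma core_ge0 x i : 0 <= core x i.
Proof. by rewrite divr_ge0 // max_weight_ge0. Qed.

Lemma core_le1 x i : core x i <= 1.
Proof. by rewrite ler_pdivrMr ?max_weight_gt0 // mul1r; apply: sub_bigmax. Qed.

Lemma core_gt0 x i : 0 < core x i ->
  exists2 p : Hom A G, \val x p != 0 & i.2 \in core_set (p i.1).
Proof.
rewrite pmulr_lgt0 ?invr_gt0 ?max_weight_gt0 //.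
by case/bigmax_gtP; rewrite ?ltxx // => -[M iM /weight_gt0[p xp pM]]; exists p; rewrite ?pM.
Qed.

(** A set [M] of maximal weight is the value at [a] of a support cell. A neighbor of [a] makes
    [nu M] nonempty, so fineness yields [g] in [core_set M], where numerator and denominator
    agree. *)
Lemma core_top x a : fine_graph G -> no_isolated A -> exists g, core x (a, g) = 1.
Proof.
move=> hG hA; have [M _ eM] : {M | M \in xpredT & max_weight x a xpredT = weight x a M}.
  by apply: (eq_bigmax finset.set0) => // M _; exact: weight_ge0.
have := max_weight_gt0 x a; rewrite eM => /weight_gt0[p _ pM].
have /andP[/forallP pn0 _] := hom_valP p; have [b ab] := hA a.
have /finset.set0Pn[g gM] : core_set M != finset.set0.
  rewrite -pM; apply: hG => //; have /finset.set0Pn[h hb] := pn0 b.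
  by apply/finset.set0Pn; exists h; apply/in_nu => k ka; exact: Hom_edge ab ka hb.
exists g; apply/le_anti; rewrite core_le1 ler_pdivlMr ?max_weight_gt0 //.
by rewrite mul1r eM le_bigmax_cond.
Qed.

Lemma continuous_max_weight (a : A) Q : continuous (fun x => max_weight x a Q).
Proof.
apply: continuous_big; first exact: max_continuous.
by move=> M _; apply: continuous_sum => p; exact: continuous_coord.
Qed.

Lemma continuous_core i : continuous (fun x => core x i).
Proof.
have cw Q : continuous (fun x => max_weight x i.1 Q).
  exact: continuous_max_weight.
move=> x; apply: (continuousM (cw _ x) (continuousV _ (cw xpredT x))).
by rewrite gt_eqF ?max_weight_gt0.
Qed.

(** An added loop compares values of a chain at one vertex, settled by [core_set_edge]; edges of [A]
    are settled by [nu_nu_edge]. *)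
Lemma core_fuzzy_looped x : fine_graph G -> no_isolated A ->
  fuzzy_hom 1 (core x : (looped A * G)%type -> R).
Proof.
move=> hG hA; have [_ _ xc] := set_valP x.
split=> [i|a|i j /= ij /core_gt0[p xp ip] /core_gt0[q xq jq]].
- by rewrite core_ge0 core_le1.
- exact: core_top.
- have pq := xc _ _ xp xq; case/orP: ij => [/eqP eij|ij].
    move: jq; rewrite -eij => jq.
    case/orP: pq => /forallP/(_ i.1) le; first exact: core_set_edge le ip jq.
    by rewrite edge_sym; exact: core_set_edge le jq ip.
  by move/setIP: ip => [_ ip]; move/setIP: jq => [_ jq]; exact: nu_nu_edge pq ij ip jq.
Qed.

(* The maximum with truncated coefficients keeps the value 1 in each fibre, as
   one of the two coefficients is always 1. *)
Definition blend x (t : R) i : R :=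
  Num.max (Num.min 1 (2 * (1 - t)) * core x i) (Num.min 1 (2 * t) * memb (\val x) i).

Lemma blend0 x i : blend x 0 i = core x i.
Proof.
rewrite /blend subr0 mulr0 mulr1 min_l ?ler1n // [Num.min 1 0]min_r ?ler01 //.
by rewrite mul1r mul0r max_l ?core_ge0.
Qed.

Lemma blend1 x i : blend x 1 i = memb (\val x) i.
Proof.
rewrite /blend subrr mulr0 mulr1 [Num.min 1 2]min_l ?ler1n //.
by rewrite [Num.min 1 0]min_r ?ler01 // mul1r mul0r max_r ?memb_ge0.
Qed.

(** The closure of [p i.1] contains both its core set and [p i.1] itself, so one bound covers both
    terms and [nu_nu_edge] applies to mixed pairs. *)
Lemma blend_gt0 x t i : 0 <= t <= 1 -> 0 < blend x t i ->
  exists2 p : Hom A G, \val x p != 0 & i.2 \in nu (nu (p i.1)).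
Proof.
case/andP=> t0 t1; rewrite lt_max => /orP[] bi.
  have /core_gt0[p xp /setIP[_ ip]] : 0 < core x i; last by exists p.
  by rewrite lt_def core_ge0 andbT; apply: contraTN bi => /eqP ->; rewrite mulr0 ltxx.
have /memb_gt0[p xp ip] : 0 < memb (\val x) i.
  by rewrite lt_def memb_ge0 andbT; apply: contraTN bi => /eqP ->; rewrite mulr0 ltxx.
by exists p => //; move: ip; apply/fintype.subsetP; exact: sub_nu_nu.
Qed.

Lemma blend_fuzzy x t : fine_graph G -> no_isolated A -> 0 <= t <= 1 ->
  fuzzy_hom 1 (blend x t).
Proof.
move=> hG hA t01; have /andP[t0 t1] := t01; have [_ _ xc] := set_valP x.
have [m01 mtop _] := memb_fuzzy x.
have b1 i : blend x t i <= 1.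
  rewrite ge_max; apply/andP; split.
    by rewrite mulr_ile1 ?core_ge0 ?core_le1 ?ge_min ?lexx // le_min ler01 mulr_ge0 ?subr_ge0.
  have /andP[m0 m1] := m01 i.
  by rewrite mulr_ile1 ?m0 ?m1 ?ge_min ?lexx // le_min ler01 mulr_ge0.
split=> [i|a|i j ij /(blend_gt0 t01)[p xp ip] /(blend_gt0 t01)[q xq jq]].
- rewrite b1 andbT le_max mulr_ge0 ?core_ge0 //.
  by rewrite le_min ler01 mulr_ge0 ?subr_ge0.
- have [t2|t2] : 1 <= 2 * (1 - t) \/ 1 <= 2 * t.
    by have [th|th] := leP t 2^-1; [left|right]; lra.
  + have [g cg] := core_top x a hG hA; exists g; apply/le_anti; rewrite b1 /=.
    by rewrite le_max cg mulr1 le_min lexx t2.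
  + have [g mg] := mtop a; exists g; apply/le_anti; rewrite b1 /=.
    by rewrite le_max mg mulr1 [X in _ || X]le_min lexx t2 orbT.
- exact: nu_nu_edge (xc _ _ xp xq) ij ip jq.
Qed.

Lemma continuous_blend i :
  continuous (fun z : rHom R A G * unit_interval R => blend z.1 (\val z.2) i).
Proof.
have cval : continuous (fun z : rHom R A G * unit_interval R => \val z.2 : R).
  move=> z; apply: (@continuous_comp _ _ _ snd (\val : unit_interval R -> R)).
    exact: cvg_snd.
  exact: initial_continuous.
have cfst (f : rHom R A G -> R) : continuous f ->
    continuous (fun z : rHom R A G * unit_interval R => f z.1).
  by move=> cf z; apply: (@continuous_comp _ _ _ fst f); [exact: cvg_fst|exact: cf].
have ccoef (f : R -> R) : continuous f ->
    continuous (fun z : rHom R A G * unit_interval R => Num.min 1 (f (\val z.2))).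
  move=> cf z; apply: (@continuous_min R _ (fun=> 1)); first exact: cst_continuous.
  exact: (continuous_comp (cval z) (cf (\val z.2))).
have cup : continuous (fun t : R => 2 * t) by move=> t; exact: mulrl_continuous.
have cdown : continuous (fun t : R => 2 * (1 - t)).
  move=> t; have cB : {for t, continuous (fun t : R => 1 - t)}.
    by apply: continuousB; [exact: cst_continuous|exact: cvg_id].
  exact: (continuous_comp cB (cup (1 - t))).
move=> z; exact: (continuous_max
  (continuousM (ccoef _ cdown z) (cfst _ (@continuous_core i) z))
  (continuousM (ccoef _ cup z) (cfst _ (@continuous_memb R A G i) z))).
Qed.
End Core.

(** * Naturality in the source graph and under automorphisms *)

Section Naturality.
Variable R : realType.

(** Memberships and weights are both sums over a predicate on cells, so this formula transports
    both. *)
Lemma sum_realization_map (d d' : Order.disp_t) (P : finPOrderType d)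
    (Q : finPOrderType d') (f : {omorphism P -> Q}) (x : realization R P)
    (S : pred Q) :
  \sum_(q | S q) \val (realization_map f x) q = \sum_(p | S (f p)) \val x p.
Proof.
rewrite [RHS](partition_big f S) //=; apply: eq_bigr => q Sq.
by apply: eq_bigl => p; case: eqP => [->|]; rewrite ?Sq ?andbF.
Qed.

Lemma memb_pullback (A B G : graph) (f : graph_hom A B) (x : rHom R B G) i :
  memb (\val (rpullback f x)) i = memb (\val x) (f i.1, i.2).
Proof.
rewrite /memb (sum_realization_map _ _ (fun q : Hom A G => i.2 \in q i.1)).
by apply: eq_bigl => p; rewrite /= ffunE.
Qed.

Lemma weight_pullback (A B G : graph) (f : graph_hom A B) (x : rHom R B G) a M :
  weight (rpullback f x) a M = weight x (f a) M.
Proof.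
rewrite /weight (sum_realization_map _ _ (fun q : Hom A G => q a == M)).
by apply: eq_bigl => p; rewrite /= ffunE.
Qed.

Lemma core_pullback (A B G : graph) (f : graph_hom A B) (x : rHom R B G) i :
  core (rpullback f x) i = core x (f i.1, i.2).
Proof.
by congr (_ / _); apply: eq_bigr => M _; exact: weight_pullback.
Qed.

Lemma blend_pullback (A B G : graph) (f : graph_hom A B) (x : rHom R B G) t i :
  blend (rpullback f x) t i = blend x t (f i.1, i.2).
Proof. by rewrite /blend core_pullback memb_pullback. Qed.

Section Automorphism.
Variables (A G : graph) (s s' : graph_hom G G).
Hypotheses (sK : cancel s s') (s'K : cancel s' s).

Lemma memb_pushforward (x : rHom R A G) a g :
  memb (\val (rpushforward s x)) (a, s g) = memb (\val x) (a, g).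
Proof.
rewrite /memb (sum_realization_map _ _ (fun q : Hom A G => s g \in q a)).
by apply: eq_bigl => p; rewrite /= ffunE (mem_imset _ _ (can_inj sK)).
Qed.

Lemma weight_pushforward (x : rHom R A G) a (M : {set G}) :
  weight (rpushforward s x) a (s @: M) = weight x a M.
Proof.
rewrite /weight (sum_realization_map _ _ (fun q : Hom A G => q a == s @: M)).
by apply: eq_bigl => p; rewrite /= ffunE (inj_eq (imset_inj (can_inj sK))).
Qed.

(** The inverse homomorphism makes [s] reflect edges as well as preserve them. *)
Lemma nu_imset (M : {set G}) : nu (s @: M) = s @: nu M.
Proof.
have es g h : edge (s g) (s h) = edge g h.
  by apply/idP/idP => [/(hom_edge s')|/(hom_edge s) //]; rewrite !sK.
apply/setP => h; rewrite -[h]s'K (mem_imset _ _ (can_inj sK)).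
apply/in_nu/in_nu => [sM k kM|sM _ /imsetP[k kM ->]].
  by rewrite -es; apply: sM; exact: imset_f.
by rewrite es; exact: sM.
Qed.

Lemma core_set_imset (M : {set G}) : core_set (s @: M) = s @: core_set M.
Proof. by rewrite /core_set !nu_imset imsetI // => ? ? _ _; exact: can_inj sK _ _. Qed.

Lemma core_pushforward (x : rHom R A G) a g :
  core (rpushforward s x) (a, s g) = core x (a, g).
Proof.
have imK : cancel (fun M : {set G} => s @: M) (fun M => s' @: M).
  by move=> M; rewrite -imset_comp (eq_imset _ sK) imset_id.
have imK' : cancel (fun M : {set G} => s' @: M) (fun M => s @: M).
  by move=> M; rewrite -imset_comp (eq_imset _ s'K) imset_id.
(* Taking images under [s] permutes the subsets of [G], so both maxima can be reindexed. *)
have bij : bijective (fun M : {set G} => s @: M) by exists (fun M : {set G} => s' @: M).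
rewrite /core /max_weight; congr (_ / _); rewrite (reindex _ (onW_bij _ bij)) /=.
  apply: eq_big => [M|M _]; last exact: weight_pushforward.
  by rewrite core_set_imset (mem_imset _ _ (can_inj sK)).
by apply: eq_bigr => M _; exact: weight_pushforward.
Qed.

Lemma blend_pushforward (x : rHom R A G) t a g :
  blend (rpushforward s x) t (a, s g) = blend x t (a, g).
Proof. by rewrite /blend core_pushforward memb_pushforward. Qed.

(** As [s] is onto, the pairs [(a, s g)] exhaust all coordinates. *)
Lemma point_pushforward (x y : rHom R A G) :
  (forall a g, memb (\val y) (a, s g) = memb (\val x) (a, g)) ->
  y = rpushforward s x.
Proof.
move=> xy; apply: point_inj => -[a g].
by rewrite -[g]s'K xy memb_pushforward.
Qed.
End Automorphism.
End Naturality.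

(** * The homotopy inverse and the two homotopies *)

Theorem theorem6p6 (R : realType) (G : graph) (hG : fine_graph G) :
  exists (j : forall T : graph, no_isolated T ->
                rHom R T G -> rHom R (looped T) G)
         (H : forall T : graph, no_isolated T ->
                rHom R T G * unit_interval R -> rHom R T G)
         (K : forall T : graph, no_isolated T ->
                rHom R (looped T) G * unit_interval R -> rHom R (looped T) G),
    [/\ forall (T : graph) (hT : no_isolated T),
          homotopy_equivalence_data (@rinclusion R T G)
            (j T hT) (H T hT) (K T hT),
        forall (T T' : graph) (hT : no_isolated T) (hT' : no_isolated T')
               (f : graph_hom T T'),
          [/\ forall x, j T hT (rpullback f x)
                        = rpullback (looped_hom f) (j T' hT' x),
              forall x t, H T hT (rpullback f x, t)
                          = rpullback f (H T' hT' (x, t)) &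
              forall y t, K T hT (rpullback (looped_hom f) y, t)
                          = rpullback (looped_hom f) (K T' hT' (y, t))] &
        forall (T : graph) (hT : no_isolated T) (s : graph_hom G G),
          is_automorphism s ->
          [/\ forall x, j T hT (rpushforward s x)
                        = rpushforward s (j T hT x),
              forall x t, H T hT (rpushforward s x, t)
                          = rpushforward s (H T hT (x, t)) &
              forall y t, K T hT (rpushforward s y, t)
                          = rpushforward s (K T hT (y, t))]].
Proof.
have looped_isolated T : no_isolated T -> no_isolated (looped T).
  by move=> hT v; have [w vw] := hT v; exists w; apply/orP; right.
have t01 (t : unit_interval R) : 0 <= \val t <= 1.
  by have := set_valP t; rewrite /= in_itv.
(* The points are picked by choice, but [point_inj] makes them unique, so naturality can be checked
   on memberships. *)
pose jw T (hT : no_isolated T) (x : rHom R T G) :=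
  cid (point_surj (core_fuzzy_looped x hG hT)).
pose bw T (hT : no_isolated T) (z : rHom R T G * unit_interval R) :=
  cid (point_surj (blend_fuzzy z.1 hG hT (t01 z.2))).
pose j T hT x : rHom R (looped T) G := projT1 (jw T hT x).
pose H T hT z : rHom R T G := projT1 (bw T hT z).
(* [core] agrees on a point for [looped T] and on its image for [T], so this homotopy starts at [j]
   after the inclusion. *)
pose K T hT := H (looped T) (looped_isolated T hT).
have jE T hT x i : memb (\val (j T hT x)) i = core x i.
  by rewrite (projT2 (jw T hT x)).
have HE T hT x t i : memb (\val (H T hT (x, t))) i = blend x (\val t) i.
  by rewrite (projT2 (bw T hT (x, t))).
have incE T x i : memb (\val (@rinclusion R T G x)) i = memb (\val x) i.
  by rewrite memb_pullback; case: i.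
have inccoreE T x i : core (@rinclusion R T G x) i = core x i.
  by rewrite core_pullback; case: i.
have cH T hT : continuous (H T hT).
  apply: continuous_rHom => i; rewrite (_ : (fun z => _) =
    fun z : rHom R T G * unit_interval R => blend z.1 (\val z.2) i).
    exact: continuous_blend.
  by apply/funext => -[x t]; exact: HE.
exists j, H, K; split=> [T hT|T T' hT hT' f|T hT s [s' [sK s'K]]].
- split.
  + apply: continuous_rHom => i; under eq_fun do rewrite incE.
    exact: continuous_memb.
  + apply: continuous_rHom => i; under eq_fun do rewrite jE.
    exact: continuous_core.
  + split=> // x; apply: point_inj => i.
      by rewrite HE blend0 incE jE.
    by rewrite HE blend1.
  + split=> [|x|x]; first exact: cH.
      by apply: point_inj => i; rewrite HE blend0 jE inccoreE.
    by apply: point_inj => i; rewrite HE blend1.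
- split=> [x|x t|y t]; apply: point_inj => i.
  + by rewrite memb_pullback !jE core_pullback.
  + by rewrite memb_pullback !HE blend_pullback.
  + by rewrite memb_pullback !HE blend_pullback.
- split=> [x|x t|y t]; apply: (point_pushforward sK s'K) => a g.
  + by rewrite !jE (core_pushforward sK s'K).
  + by rewrite !HE (blend_pushforward sK s'K).
  + by rewrite !HE (blend_pushforward sK s'K).
Qed.
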